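(* $\vartheta_0\vartheta_1\Omega_2=\omega^{\omega^{\omega}}$; that is, the initial segment $\{\gamma\in T:\gamma<\vartheta_0\vartheta_1\Omega_2\}$ of the well-order $(T,<)$ has order type $\omega^{\omega^{\omega}}$.
   Context: The set of formal terms $T$ and the function $S$ are defined simultaneously: $T$ is the least set such that $0\in T$, with $S(0):=-1$, and whenever $\alpha\in T$, $i\in\mathbb{N}$ and $S(\alpha)\le i+1$, then $\vartheta_i\alpha\in T$ with $S(\vartheta_i\alpha):=i$. Put $\Omega_i:=\vartheta_i0\in T$. Coefficients: $k_i(0):=0$; $k_i(\vartheta_j\beta):=\vartheta_j\beta$ if $j\le i$, and $k_i(\vartheta_j\beta):=k_i(\beta)$ if $j>i$. The ordering $<$ on $T$ (with $\le$ meaning $<$ or $=$) is defined recursively by: (1) $0<\alpha$ if $\alpha\neq0$; (2) if $i<j$, then $\vartheta_i\alpha<\vartheta_j\beta$; (3) if $\alpha<\beta$ and $k_i\alpha<\vartheta_i\beta$, then $\vartheta_i\alpha<\vartheta_i\beta$; (4) if $\alpha>\beta$ and $\vartheta_i\alpha\le k_i\beta$, then $\vartheta_i\alpha<\vartheta_i\beta$. This is a well-order on $T$. A term of $T$, when regarded as an ordinal, denotes the order type of the set of its predecessors in $(T,<)$. Here $\{\gamma\in T:\gamma<\vartheta_0\vartheta_1\Omega_2\}$ is the set $T_2[0]$ of terms that contain only the symbols $0,\vartheta_0,\vartheta_1$ and satisfy $S\le 0$. *)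

(* Defs.v *)
From Stdlib Require List.
From mathcomp Require Import all_boot all_order all_algebra.
Set Implicit Arguments.
Unset Strict Implicit.
Unset Printing Implicit Defensive.

Inductive preterm : Type :=
| Zero : preterm
| Theta : nat -> preterm -> preterm.

Definition Slevel (a : preterm) : int :=
  match a with
  | Zero => (-1)%R
  | Theta i _ => i%:Z
  end.

(* Since [Slevel] only looks at the outermost symbol, the simultaneous
   definition of T and S can be disentangled: S is given on all preterms, and
   [in_T] is then the least predicate closed under the two formation rules. *)
Fixpoint in_T (a : preterm) : bool :=
  match a with
  | Zero => true
  | Theta i b => in_T b && (Slevel b <= i%:Z + 1)%R
  end.

Fixpoint coef (i : nat) (a : preterm) : preterm :=
  match a with
  | Zero => Zero
  | Theta j b => if j <= i then Theta j b else coef i b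
  end.

(* The recursive clauses only compare smaller terms, so the least relation
   closed under them is the relation they define.  It is stated on preterms;
   as subterms of elements of T are in T, and [coef i a] is a subterm of [a] or
   [Zero], derivations between elements of T never leave T. *)
Inductive preterm_lt : preterm -> preterm -> Prop :=
| lt_zero a : a <> Zero -> preterm_lt Zero a
| lt_index i j a b : i < j -> preterm_lt (Theta i a) (Theta j b)
| lt_arg i a b :
    preterm_lt a b -> preterm_lt (coef i a) (Theta i b) ->
    preterm_lt (Theta i a) (Theta i b)
| lt_coef i a b :
    preterm_lt b a ->
    preterm_lt (Theta i a) (coef i b) \/ Theta i a = coef i b ->
    preterm_lt (Theta i a) (Theta i b).

Definition T : Type := {a : preterm | in_T a}.

Definition zero : T := exist _ Zero isT.

Lemma in_T_Theta (i : nat) (a : T) :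
  (Slevel (sval a) <= i%:Z + 1)%R -> in_T (Theta i (sval a)).
Proof. by case: a => a /= -> ->. Qed.

Definition theta (i : nat) (a : T) (h : (Slevel (sval a) <= i%:Z + 1)%R) : T :=
  exist _ (Theta i (sval a)) (in_T_Theta h).

Definition Omega (i : nat) : T := @theta i zero isT.

Definition T_lt (a b : T) : Prop := preterm_lt (sval a) (sval b).

Record ordered_set : Type := OrderedSet {
  carrier :> Type;
  olt : carrier -> carrier -> Prop
}.

Definition T_ord : ordered_set := OrderedSet T_lt.

Definition predecessors (A : ordered_set) (a : A) : ordered_set :=
  @OrderedSet {x : A | olt x a} (fun x y => olt (sval x) (sval y)).

(* Equality of order types. *)
Definition same_order_type (A B : ordered_set) : Prop :=
  exists f : A -> B,
    bijective f /\ forall x y : A, olt x y <-> olt (f x) (f y).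

Definition omega : ordered_set := @OrderedSet nat (fun m n => m < n).

Definition is_least (A : ordered_set) (a : A) : Prop :=
  forall x : A, ~ olt x a.

Definition finite_support (A B : ordered_set) (f : B -> A) : Prop :=
  exists l : seq B, forall b : B, ~ List.In b l -> is_least (f b).

(* Exponentiation of well-orders: if A and B have order types alpha and beta,
   then the finitely supported functions from B to A, compared at the largest
   argument where they differ, have order type alpha ^ beta. *)
Definition oexp (A B : ordered_set) : ordered_set :=
  @OrderedSet {f : B -> A | finite_support f}
    (fun f g => exists b : B,
       olt (sval f b) (sval g b) /\
       forall c : B, olt b c -> sval f c = sval g c).

(* Main.v *)
From HB Require Import structures.
Require Import Defs.
From mathcomp Require Import all_boot all_order all_algebra.
From mathcomp Require Import boolp.

(** An ordinal below omega ^ (omega ^ omega) is a non-increasing finite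
    sequence (its Cantor normal form) of exponents below omega ^ omega, and such
    an exponent is in turn a non-increasing finite sequence of natural numbers.
    Comparing Cantor normal forms is comparing sequences lexicographically, so
    the order type in question is that of [cnf (cnf nat)].  The link with the
    finitely supported functions is that a normal form is determined by the
    multiplicities of its exponents ([same_order_type_oexp], applied twice).

    A term below [Theta 0 (Theta 1 Omega_2)] uses only the symbols 0, [Theta 0]
    and [Theta 1] ([lt_bound]).  Write such a term as n symbols [Theta 1] in
    front of a term c that is 0 or starts with [Theta 0].  The value of c is an
    ordinal x, and that of the whole term is the pair (n, x), to be read as
    Omega * n + x and compared lexicographically.  Then [Theta 0] becomes a
    function of (n, x):
    - [Theta 0] of (0, x) is x + 1;
    - [Theta 0] of (m + 1, x) is omega ^ (omega ^ m) * x, except that x + 1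
      replaces x when x = omega ^ (omega ^ (m + 1)) * e + k with k finite.
      When k = 0 the product x would be a fixed point, whereas [Theta 0] of a
      term always exceeds the coefficient x; the shift must then be passed on
      to the finite successors x + k to keep the function injective.
    On normal forms these operations are elementary: adding 1 appends the zero
    exponent, and multiplying on the left by omega ^ (omega ^ m) adds
    omega ^ m on the left of every exponent ([pow_add]), that is, puts m in
    front of the exponent unless the exponent absorbs it.

    Three facts carry the comparison.  The function increases x
    ([theta0_gt]), is strictly monotone in x ([theta0_homo]), and its values
    with first argument m are closed under the functions with first argument
    n < m ([theta0_closed]).  They give [theta0_lt]: the ordinal function obeys
    the recursion that defines the order of terms.  Hence the value map
    preserves and reflects the order ([preterm_lt_value]).  It is onto because
    every nonzero ordinal is a value of the function at a normal form with fewer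
    symbols ([theta0_surj]), so that a preimage term is found by recursion. *)

Set Implicit Arguments.
Unset Strict Implicit.
Unset Printing Implicit Defensive.

Import Order.TTheory DefaultSeqLexiOrder.

Local Open Scope order_scope.

(** * Lexicographically ordered sequences *)

Lemma ltxi_consE d (L : orderType d) (a b : L) (s t : seq L) :
  (a :: s < b :: t) = (a < b) || (a == b) && (s < t).
Proof. by rewrite ltxi_cons; case: (ltgtP a b) => /=. Qed.

Lemma ltxi_rcons d (L : orderType d) (s : seq L) (a : L) : s < rcons s a.
Proof. by elim: s => [|b s IHs] //=; rewrite ltxi_consE eqxx IHs orbT. Qed.

(** Appending the least letter is the successor operation of the
    lexicographic order. *)
Lemma rcons_least_lexi d (L : orderType d) (c : L) (s t : seq L) :
  (forall a, c <= a) -> s < t -> rcons s c <= t.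
Proof.
move=> c_min; elim: s t => [|a s IHs] [|b t] //=.
  by rewrite lexi_cons c_min lexi0s implybT.
rewrite ltxi_consE => /orP[|/andP[/eqP<- /IHs st]].
  by rewrite lexi_cons => ab; rewrite (ltW ab) lt_geF.
by rewrite eqhead_lexiE.
Qed.

Lemma lexi_map_homo d (L : orderType d) (f : L -> L) (s t : seq L) :
  {homo f : a b / a < b} -> s < t -> map f s < map f t.
Proof.
move=> f_homo; elim: s t => [|a s IHs] [|b t] //=.
rewrite !ltxi_consE => /orP[/f_homo->//|/andP[/eqP-> /IHs->]].
by rewrite eqxx orbT.
Qed.

Lemma lexi_map_ge d (L : orderType d) (f : L -> L) (s : seq L) :
  (forall a, a <= f a) -> s <= map f s.
Proof.
by move=> f_ge; elim: s => [|a s IHs] //=; rewrite lexi_cons f_ge IHs implybT.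
Qed.

(** * Cantor normal forms *)

(** The sequence a_1 >= ... >= a_k stands for
    omega ^ a_1 + ... + omega ^ a_k; the lexicographic order on these
    sequences is the order of the ordinals. *)
Record cnf d (L : orderType d) := Cnf {
  cnf_val :> seq L;
  _ : sorted >=%O cnf_val
}.

HB.instance Definition _ d (L : orderType d) := [isSub for @cnf_val d L].
HB.instance Definition _ d (L : orderType d) := [Choice of cnf L by <:].
HB.instance Definition _ d (L : orderType d) :=
  [SubChoice_isSubOrder of cnf L by <: with d].

Lemma cnf_sorted d (L : orderType d) (x : cnf L) : sorted >=%O (x : seq L).
Proof. exact: valP x. Qed.

Definition cnf_nil d (L : orderType d) : cnf L := @Cnf d L [::] isT.

Lemma cnf_nil_le d (L : orderType d) (x : cnf L) : cnf_nil L <= x.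
Proof. by rewrite leEsub lexi0s. Qed.

(** The lexicographic order looks at the first difference, the exponential
    looks at the largest exponent whose multiplicity differs: for
    non-increasing sequences the exponent found at the first difference in the
    larger sequence is such an exponent, since whatever comes later in either
    sequence is not above it. *)
Lemma lt_cnf_countP d (L : orderType d) (x y : cnf L) :
  x < y ->
  exists2 a, (count_mem a x < count_mem a y)%N &
    forall b, a < b -> count_mem b x = count_mem b y.
Proof.
case: x y => [s s_sorted] [t t_sorted]; rewrite ltEsub /=.
elim: s t s_sorted t_sorted => [|a s IHs] [|b t] //= s_sorted t_sorted.
  move=> _; exists b; rewrite ?eqxx // => c bc.
  rewrite (lt_eqF bc) (@count_memPn _ c t _) //; apply/negP => ct.
  have /allP/(_ c ct) := order_path_min (@ge_trans d L) t_sorted.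
  by rewrite /= leNgt bc.
rewrite ltxi_consE => /orP[ab|/andP[/eqP<- st]]; last first.
  have [c cst c_top] := IHs t (path_sorted s_sorted) (path_sorted t_sorted) st.
  by exists c => [|e ce]; rewrite ?ltn_add2l // c_top.
have above (c : L) u (e : L) : path >=%O e u -> e < c -> count_mem c u = 0%N.
  move=> eu ec; apply/count_memPn/negP => cu.
  have /allP/(_ c cu) := order_path_min (@ge_trans d L) eu.
  by rewrite /= leNgt ec.
exists b => [|c bc].
  by rewrite eqxx (lt_eqF ab) (above b s a).
by rewrite (lt_eqF bc) (lt_eqF (lt_trans ab bc)) (above c s a) ?(above c t b) ?(lt_trans ab).
Qed.

(** Both orders are linear, so the implication [lt_cnf_countP] already gives
    its converse. *)
Lemma lt_cnf_count d (L : orderType d) (x y : cnf L) (a : L) :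
  (count_mem a x < count_mem a y)%N ->
  (forall b, a < b -> count_mem b x = count_mem b y) -> x < y.
Proof.
move=> axy a_top; have [//|yx|xy] := ltgtP x y; last by rewrite xy ltnn in axy.
have [b byx b_top] := lt_cnf_countP yx.
have [ab|ba|ab] := ltgtP a b.
- by rewrite a_top ?ltnn in byx.
- by rewrite b_top ?ltnn in axy.
- by rewrite ab ltnNge ltnW in axy.
Qed.

Lemma cnf_count_inj d (L : orderType d) (x y : cnf L) :
  (forall a, count_mem a x = count_mem a y) -> x = y.
Proof.
move=> xy; apply/val_inj/(sorted_eq (@ge_trans d L) _ (cnf_sorted x) (cnf_sorted y)).
  by move=> a b; rewrite andbC => /le_anti.
by apply/allP => a _ /=; rewrite xy.
Qed.

(** * Exponentials with base omega *)

Definition ord d (L : orderType d) : ordered_set :=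
  OrderedSet (fun x y : L => (x < y : Prop)).

Lemma same_order_type_bij (A B : ordered_set) (f : A -> B) :
  injective f -> (forall b, exists a, f a = b) ->
  (forall x y, olt x y <-> olt (f x) (f y)) -> same_order_type A B.
Proof.
move=> f_inj /choice[g gK] f_lt; exists f; split=> //.
by exists g => [a|b] //; apply: f_inj.
Qed.

Definition cnf_of_count d (L : orderType d) (supp : seq L) (h : L -> nat) :
  cnf L :=
  Cnf (sort_sorted (@ge_total d L)
         (flatten [seq nseq (h a) a | a <- undup supp])).

Lemma count_cnf_of_count d (L : orderType d) (supp : seq L) (h : L -> nat) a :
  (a \notin supp -> h a = 0%N) ->
  count_mem a (cnf_of_count supp h) = h a.
Proof.
move=> h_supp; rewrite /= count_sort.
rewrite -mem_undup in h_supp; have := undup_uniq supp.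
elim: (undup supp) h_supp => [|b s IHs] /= h_s => [_|/andP[bs s_uniq]].
  by rewrite h_s.
rewrite count_cat count_nseq /=; case: (eqVneq b a) => [<-|ba].
  rewrite mul1n (_ : count _ _ = 0%N) ?addn0 //.
  apply/count_memPn/negP => /flatten_mapP[c cs].
  by rewrite mem_nseq => /andP[_ /eqP bc]; rewrite bc cs in bs.
by rewrite mul0n IHs // => a_s; apply: h_s; rewrite inE eq_sym (negbTE ba).
Qed.

(** A normal form goes to the function that sends an exponent to its
    multiplicity. *)
Lemma same_order_type_oexp d (L : orderType d) (X : ordered_set) :
  same_order_type (ord L) X -> same_order_type (ord (cnf L)) (oexp omega X).
Proof.
case=> f [[g fK gK] f_lt].
have supp_count (x : cnf L) :
    @finite_support omega X (fun b => count_mem (g b) x).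
  exists (map f x) => b b_x k; rewrite /= (count_memPn _) //.
  apply/negP => gb_x; apply: b_x; rewrite -[b]gK.
  by elim: (x : seq L) gb_x => //= a s IHs /predU1P[->|/IHs]; [left|right].
pose q x : oexp omega X := exist _ _ (supp_count x).
have q_eq x y : q x = q y -> forall a, count_mem a x = count_mem a y.
  move=> /(congr1 (fun h => sval h)) /= xy a.
  by have /= := congr1 (fun h => h (f a)) xy; rewrite fK.
apply: (@same_order_type_bij (ord (cnf L)) _ q) => /=.
- by move=> x y /q_eq/cnf_count_inj.
- move=> [h [l h_l]]; exists (cnf_of_count (map g l) (h \o f)).
  apply: eq_exist; apply: funext => b; rewrite count_cnf_of_count /= gK //.
  have In_map (e : seq X) c : List.In c e -> g c \in map g e.
    by elim: e => //= c0 e IHe [->|/IHe]; rewrite inE ?eqxx // => ->; rewrite orbT.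
  move=> b_l; have {}/h_l: ~ List.In b l by move=> /In_map; apply/negP.
  by case: (h b) => // k /(_ 0%N) [].
move=> x y; split=> [/lt_cnf_countP[a axy a_top]|[b /= [bxy b_top]]].
  exists (f a); split=> [|c]; rewrite /= ?fK // => ac; apply: a_top.
  by apply/f_lt; rewrite gK.
apply: (lt_cnf_count bxy) => a ba.
by rewrite -[a]fK b_top // -[b]gK; apply/f_lt.
Qed.

(** * The ordinal function denoted by the symbol of index 0 *)

(** The normal form of omega ^ n + a.  The default value of [insubd] does the
    absorption: [n :: a] fails to be non-increasing exactly when a starts with an
    exponent above n, and then omega ^ n + a = a. *)
Definition pow_add (n : nat) (a : cnf nat) : cnf nat := insubd a (n :: a).

Lemma val_pow_add n a :
  pow_add n a = (if path >=%O n a then n :: a else a) :> seq nat.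
Proof. by rewrite val_insubd. Qed.

Variant pow_add_spec n (a : cnf nat) : seq nat -> Type :=
| PowAddCons of path >=%O n a : pow_add_spec n a (n :: a)
| PowAddAbsorbed m s of a = m :: s :> seq nat & (n < m)%N :
    pow_add_spec n a (m :: s).

Lemma pow_addP n a : pow_add_spec n a (pow_add n a).
Proof.
rewrite val_pow_add; case: ifP => [|]; first by left.
case: a => -[|m s] //= ms; rewrite ms andbT => /negbT; rewrite -ltNge => nm.
by apply: PowAddAbsorbed.
Qed.

Lemma pow_add_ge n a : a <= pow_add n a.
Proof.
rewrite leEsub /=; case: pow_addP => [|m s -> //].
case: a => s s_sorted /=; elim: s n s_sorted => [|m s IHs] n //= s_sorted.
by case/andP=> mn _; rewrite lexi_cons mn IHs ?implybT // (path_sorted s_sorted).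
Qed.

Lemma pow_add_homo n : {homo pow_add n : a b / a < b}.
Proof.
move=> a b; rewrite !ltEsub /=.
case: (pow_addP n a) => [na|k s ak nk]; case: (pow_addP n b) => [nb|m t bm nm].
- by rewrite ltxi_consE eqxx => ->; rewrite orbT.
- by move=> _; rewrite ltxi_consE ltEnat /= nm.
- rewrite ak; case: (b : seq nat) nb => [|m t] //= /andP[mn _].
  rewrite !leEnat in mn; rewrite ltxi_consE ltEnat /= => /orP[km|/andP[/eqP km _]].
    by have := leq_trans (ltn_trans nk km) mn; rewrite ltnn.
  by have := leq_trans nk (leq_trans (eq_leq km) mn); rewrite ltnn.
- by rewrite ak bm.
Qed.

Lemma pow_add_absorb n m a : (n < m)%N -> pow_add n (pow_add m a) = pow_add m a.
Proof.
move=> nm; apply/val_inj; rewrite /= val_pow_add.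
case: (pow_addP m a) => [_|k s _ mk] /=; first by rewrite leEnat leqNgt nm.
by rewrite leEnat leqNgt (ltn_trans nm mk).
Qed.

Lemma pow_add_neq_nil n a : pow_add n a != cnf_nil nat.
Proof. by rewrite -val_eqE /=; case: pow_addP. Qed.

Definition cnf_succ (x : cnf (cnf nat)) : cnf (cnf nat) :=
  insubd x (rcons x (cnf_nil nat)).

Lemma val_cnf_succ x : cnf_succ x = rcons x (cnf_nil nat) :> seq (cnf nat).
Proof.
rewrite val_insubd ifT //; case: x => -[|a s] //= s_sorted.
by rewrite rcons_path s_sorted /= cnf_nil_le.
Qed.

Lemma map_pow_add_sorted n (x : cnf (cnf nat)) :
  sorted >=%O (map (pow_add n) x).
Proof.
rewrite sorted_map; apply: sub_sorted (cnf_sorted x) => a b /=.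
by rewrite (le_mono (@pow_add_homo n)).
Qed.

(** The normal form of omega ^ (omega ^ n) * x, by distributivity on the left
    and omega ^ b * omega ^ a = omega ^ (b + a). *)
Definition pow_pow_mul n (x : cnf (cnf nat)) : cnf (cnf nat) :=
  Cnf (map_pow_add_sorted n x).

(** An exponent a satisfies omega ^ n + a = a iff it is at least
    omega ^ (n + 1), so this says that x is a multiple of
    omega ^ (omega ^ (n + 1)), which are the fixed points of [pow_pow_mul n],
    plus a natural number. *)
Definition fixed_plus_nat n (x : cnf (cnf nat)) : bool :=
  all (fun a => (a == cnf_nil nat) || (pow_add n a == a)) x.

(** The ordinal denoted by [Theta 0] of a term of value (n, x). *)
Definition theta0 (n : nat) (x : cnf (cnf nat)) : cnf (cnf nat) :=
  if n is m.+1 then pow_pow_mul m (if fixed_plus_nat m x then cnf_succ x else x)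
  else cnf_succ x.

Lemma cnf_succ_gt x : x < cnf_succ x.
Proof. by rewrite ltEsub /= val_cnf_succ ltxi_rcons. Qed.

Lemma cnf_succ_le x y : x < y -> cnf_succ x <= y.
Proof.
rewrite ltEsub leEsub /= val_cnf_succ => xy.
exact/rcons_least_lexi/xy/cnf_nil_le.
Qed.

Lemma pow_pow_mul_homo n : {homo pow_pow_mul n : x y / x < y}.
Proof. by move=> x y; rewrite !ltEsub => /lexi_map_homo; apply; apply: pow_add_homo. Qed.

Lemma pow_pow_mul_ge n x : x <= pow_pow_mul n x.
Proof. by rewrite leEsub; apply/lexi_map_ge/pow_add_ge. Qed.

Lemma fixed_plus_nat_succ n x : fixed_plus_nat n (cnf_succ x) = fixed_plus_nat n x.
Proof. by rewrite /fixed_plus_nat val_cnf_succ all_rcons eqxx. Qed.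

(** Multiplication never decreases x, and it leaves x unchanged only at the
    fixed points, where [theta0] passes to x + 1 beforehand. *)
Lemma theta0_gt n x : x < theta0 n x.
Proof.
case: n => [|n] /=; first exact: cnf_succ_gt.
case: ifPn => [_|/allPn[a ax]].
  exact: lt_le_trans (cnf_succ_gt x) (pow_pow_mul_ge _ _).
rewrite lt_neqAle pow_pow_mul_ge andbT negb_or => /andP[_ a_not_fixed].
apply: contraNneq a_not_fixed => /(congr1 val) /= x_fixed.
have /eq_in_map/(_ a ax)/= <- // : map id x = map (pow_add n) x.
by rewrite map_id -x_fixed.
Qed.

(** The only critical case is a shifted x below an unshifted y.  There
    x + 1 <= y, and equality is impossible since x + 1 would be shifted as
    well. *)
Lemma theta0_homo n : {homo theta0 n : x y / x < y}.
Proof.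
case: n => [|n] x y xy /=.
  exact: le_lt_trans (cnf_succ_le xy) (cnf_succ_gt y).
apply: pow_pow_mul_homo.
case: ifP => fx; case: ifP => fy //.
- exact: le_lt_trans (cnf_succ_le xy) (cnf_succ_gt y).
- rewrite lt_neqAle cnf_succ_le // andbT.
  by apply: contraFneq fy => <-; rewrite fixed_plus_nat_succ.
- exact: lt_trans xy (cnf_succ_gt y).
Qed.

(** A multiple of omega ^ (omega ^ n) is a limit: no exponent in its normal
    form is zero. *)
Lemma cnf_succ_lt_mul n x y :
  x < pow_pow_mul n y -> cnf_succ x < pow_pow_mul n y.
Proof.
move=> xy; rewrite lt_neqAle cnf_succ_le // andbT.
apply/eqP => /(congr1 val) /=; rewrite val_cnf_succ => xy_eq.
have : cnf_nil nat \in map (pow_add n) y by rewrite -xy_eq mem_rcons mem_head.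
by case/mapP=> a _ /esym/eqP; apply/negP/pow_add_neq_nil.
Qed.

(** Values of [theta0 m] are limits if 0 < m, and fixed points of
    multiplication by omega ^ (omega ^ k) if k + 1 < m; a strictly monotone map
    keeps what is below one of its fixed points below it. *)
Lemma theta0_closed n m x y : (n < m)%N -> x < theta0 m y -> theta0 n x < theta0 m y.
Proof.
case: m => //= m; rewrite ltnS; set z := (if _ then _ else _) => nm xz.
case: n nm => [|n] nm /=; first exact: cnf_succ_lt_mul.
have zE : pow_pow_mul m z = pow_pow_mul n (pow_pow_mul m z).
  apply/val_inj; rewrite /= -map_comp; apply: eq_map => a /=.
  by rewrite pow_add_absorb.
by rewrite zE; apply: pow_pow_mul_homo; case: ifP => // _; apply: cnf_succ_lt_mul.
Qed.

Lemma theta0_inj n m x y : theta0 n x = theta0 m y -> n = m /\ x = y.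
Proof.
have lt_neq n' m' x' y' : (n' < m')%N -> theta0 n' x' <> theta0 m' y'.
  move=> nm xy; have := theta0_gt n' x'; rewrite xy => /(theta0_closed nm).
  by rewrite xy ltxx.
case: (ltngtP n m) => [nm|mn|<-] xy; [by case: (lt_neq _ _ x y nm)| |].
  by case: (lt_neq _ _ y x mn).
by split=> //; apply: (inc_inj (le_mono (@theta0_homo n))) xy.
Qed.

(** The number of symbols of a normal form, on which the search for a
    preimage recurses. *)
Definition cnf_weight (s : seq (cnf nat)) : nat :=
  sumn [seq (size (a : seq nat)).+1 | a : cnf nat <- s].

Lemma cnf_weight_rcons s a :
  cnf_weight (rcons s a) = (cnf_weight s + (size (a : seq nat)).+1)%N.
Proof. by rewrite /cnf_weight map_rcons sumn_rcons. Qed.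

(** A partial left subtraction: inverts [pow_add n] on the exponents that are
    at least omega ^ n. *)
Definition pow_sub n (a : cnf nat) : cnf nat :=
  if ohead a == Some n then insubd a (behead a) else a.

Lemma val_pow_sub n a :
  pow_sub n a = (if ohead a == Some n then behead a else a) :> seq nat.
Proof.
rewrite /pow_sub; case: ifP => // _; rewrite val_insubd ifT //.
by case: a => -[|m s] //= /path_sorted.
Qed.

Lemma size_pow_sub n a : (size (pow_sub n a : seq nat) <= size (a : seq nat))%N.
Proof.
by rewrite val_pow_sub; case: ifP => // _; rewrite size_behead leq_pred.
Qed.

Lemma pow_subK n s (a b : cnf nat) :
  a = n :: s :> seq nat -> a <= b -> pow_add n (pow_sub n b) = b.
Proof.
move=> aE ab; apply/val_inj => /=; rewrite val_pow_add val_pow_sub.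
case: b ab => -[|k t] b_sorted; rewrite leEsub /= aE // lexi_cons.
case/andP=> nk _ /=; case: eqP => [[<-]|kn] /=; first by have /= -> := b_sorted.
rewrite !leEnat /= in nk *; case: ifP => // /andP[kn' _].
by case: kn; congr Some; apply/eqP; rewrite eqn_leq kn' nk.
Qed.

(** A successor is [theta0 0] of its predecessor.  A limit has a nonzero last
    exponent a, with some first entry n; every exponent is at least a, hence at
    least omega ^ n, and subtracting omega ^ n from all of them gives z with
    omega ^ (omega ^ n) * z equal to the given ordinal.  If [theta0 n.+1] shifts
    z, then z is a successor, because the last exponent was changed by the
    subtraction and so is not fixed by [pow_add n]; its predecessor is the
    preimage. *)
Lemma theta0_surj y :
  y != cnf_nil _ ->
  exists n x, theta0 n x = y /\ (cnf_weight x < cnf_weight y)%N.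
Proof.
case: y => s; case/lastP: s => [//|s a] s_sorted _.
have sa_ge b : b \in rcons s a -> a <= b.
  have: sorted <=%O (a :: rev s).
    by rewrite -rev_rcons -[sorted _ _](rev_sorted >=%O) revK.
  rewrite /= (path_sortedE le_trans) => /andP[/allP ge_a _].
  by rewrite mem_rcons inE => /predU1P[->//|bs]; apply: ge_a; rewrite mem_rev.
have s'_sorted : sorted >=%O s by apply: subseq_sorted (subseq_rcons s a) s_sorted; apply: ge_trans.
case aE : (a : seq nat) => [|n t].
  exists 0%N, (Cnf s'_sorted); split; last by rewrite /= cnf_weight_rcons aE addn1.
  apply/val_inj; rewrite /= val_cnf_succ /=; congr rcons.
  exact/val_inj.
pose z := map (pow_sub n) (rcons s a).
have zK : map (pow_add n) z = rcons s a.
  rewrite -map_comp -[RHS]map_id; apply/eq_in_map => b /sa_ge ab.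
  exact: pow_subK aE ab.
have z_sorted : sorted >=%O z.
  move: s_sorted; rewrite -zK sorted_map; apply: sub_sorted => b c /=.
  by rewrite (le_mono (@pow_add_homo n)).
have z_weight : (cnf_weight z < cnf_weight (rcons s a))%N.
  rewrite /z map_rcons !cnf_weight_rcons -addnS leq_add //.
    by elim: (s) => //= b u IHu; rewrite leq_add // ltnS size_pow_sub.
  by rewrite ltnS val_pow_sub aE /= eqxx.
case fz : (fixed_plus_nat n (Cnf z_sorted)); last first.
  by exists n.+1, (Cnf z_sorted); rewrite /= fz; split=> //; apply/val_inj.
pose z' := map (pow_sub n) s.
have zE : z = rcons z' (cnf_nil nat).
  rewrite /z map_rcons; congr rcons; apply/eqP.
  move: fz; rewrite /fixed_plus_nat /= /z map_rcons all_rcons => /andP[/predU1P[->//|]].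
  rewrite (pow_subK aE) // => /eqP/(congr1 (fun b => size (cnf_val b))) /=.
  by rewrite aE val_pow_sub aE eqxx /= => /eqP; rewrite gtn_eqF.
have z'_sorted : sorted >=%O z'.
  apply: (subseq_sorted (@ge_trans _ _) _ z_sorted).
  by rewrite zE subseq_rcons.
have z'E : cnf_succ (Cnf z'_sorted) = Cnf z_sorted.
  by apply/val_inj; rewrite /= val_cnf_succ zE.
exists n.+1, (Cnf z'_sorted); split.
  by rewrite /= -fixed_plus_nat_succ z'E fz; apply/val_inj.
apply: leq_ltn_trans z_weight; rewrite /= zE cnf_weight_rcons; exact: leq_addr.
Qed.

(** The pair (n, x) stands for Omega * n + x. *)
Definition lexpair := (nat *l cnf (cnf nat))%type.

Lemma lt_lexpair (u v : lexpair) :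
  (u < v) = (u.1 < v.1)%N || (u.1 == v.1) && (u.2 < v.2).
Proof. by rewrite ltEprodlexi leEnat; case: ltngtP. Qed.

(** The third and fourth clauses of the definition of the order, read on
    values: the coefficient of index 0 of a term of value (n, x) has value x. *)
Lemma theta0_lt n m x y :
  theta0 n x < theta0 m y <->
  ((n, x) < (m, y) :> lexpair /\ x < theta0 m y) \/
  ((m, y) < (n, x) :> lexpair /\ theta0 n x <= y).
Proof.
have suff_lt p q z t :
    (p, z) < (q, t) :> lexpair -> z < theta0 q t -> theta0 p z < theta0 q t.
  rewrite lt_lexpair /= => /orP[pq|/andP[/eqP-> zt] _]; first exact: theta0_closed.
  exact: theta0_homo.
split=> [xy|[[]|[_ xy]]]; first 1 last.
- exact: suff_lt.
- exact: le_lt_trans xy (theta0_gt m y).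
have [nm|mn|[nm xy']] := ltgtP ((n, x) : lexpair) (m, y).
- by left; split=> //; apply: lt_trans (theta0_gt n x) xy.
- right; split=> //; rewrite leNgt; apply: contraTN xy => /(suff_lt _ _ _ _ mn).
  by rewrite -leNgt => /ltW.
- by rewrite nm xy' ltxx in xy.
Qed.

(** * Terms and their values *)

Fixpoint low (a : preterm) : bool :=
  if a is Theta i b then (i < 2)%N && low b else true.

(** Only meant for [low] terms; the other symbols are treated as [Theta 1]. *)
Fixpoint value (a : preterm) : lexpair :=
  match a with
  | Zero => (0%N, cnf_nil _)
  | Theta 0 b => (0%N, theta0 (value b).1 (value b).2)
  | Theta _ b => ((value b).1.+1, (value b).2)
  end.

Lemma low_coef i a : low a -> low (coef i a).
Proof. by elim: a => //= j a IHa /andP[j2 /[dup] low_a /IHa]; case: ifP; rewrite //= j2. Qed.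

Lemma value_coef0 a : low a -> value (coef 0 a) = (0%N, (value a).2).
Proof. by elim: a => // -[|[|i]] a IHa //= /IHa. Qed.

Lemma coef1_low a : low a -> coef 1 a = a.
Proof. by case: a => // -[|[|i]]. Qed.

Lemma value_inj : {in low &, injective value}.
Proof.
have theta0_neq n x : theta0 n x <> cnf_nil _.
  by move=> x0; have := le_lt_trans (cnf_nil_le _) (theta0_gt n x); rewrite x0 ltxx.
elim=> [|[|[|i]] a IHa] [|[|[|j]] b] //= low_a low_b.
- by case=> /esym/theta0_neq.
- by case=> /theta0_neq.
- by case=> /theta0_inj[ab1 ab2]; rewrite (IHa b) // [LHS]surjective_pairing ab1 ab2 -surjective_pairing.
- by case=> ab1 ab2; rewrite (IHa b) // [LHS]surjective_pairing ab1 ab2 -surjective_pairing.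
Qed.

Lemma preterm_lt_Zero a : ~ preterm_lt a Zero.
Proof. by move=> a0; inversion a0. Qed.

Lemma preterm_lt_Theta i j a b :
  preterm_lt (Theta i a) (Theta j b) <->
  (i < j)%N \/ i = j /\
    (preterm_lt a b /\ preterm_lt (coef i a) (Theta i b) \/
     preterm_lt b a /\
       (preterm_lt (Theta i a) (coef i b) \/ Theta i a = coef i b)).
Proof.
split; last first.
  case=> [|[<- [[ab coef_a]|[ba coef_b]]]]; first exact: lt_index.
    exact: lt_arg.
  exact: lt_coef.
by move=> ab; inversion ab; subst; [left|right; split=> //; left|right; split=> //; right].
Qed.

Fixpoint depth (a : preterm) : nat := if a is Theta _ b then (depth b).+1 else 0%N.

Lemma depth_coef i a : (depth (coef i a) <= depth a)%N.
Proof. by elim: a => //= j a IHa; case: ifP => //= _; apply: leqW. Qed.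

(** Induction on the total depth, as the clauses that define the order compare
    a term with a coefficient of the other one.  Between two [Theta 0] terms,
    the recursion for terms and [theta0_lt] agree literally.  Between two
    [Theta 1] terms, the coefficients are the arguments themselves, and the
    order is that of the arguments because b < [Theta 1] b. *)
Lemma preterm_lt_value a b :
  low a -> low b -> (preterm_lt a b <-> value a < value b).
Proof.
have [w] := ubnP (depth a + depth b)%N; elim: w a b => // w IHw a b.
case: a => [|i a]; case: b => [|j b] /=.
- by move=> _ _ _; split=> [/preterm_lt_Zero|]; rewrite ?ltxx.
- move=> _ _ low_b; split=> _; last exact: lt_zero.
  case: j low_b => [|j] _; rewrite lt_lexpair //=.
  exact: le_lt_trans (cnf_nil_le _) (theta0_gt _ _).
- move=> _ low_a _; split=> [/preterm_lt_Zero//|].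
  by case: i low_a => [|i] _; rewrite lt_lexpair //= ltNge cnf_nil_le.
rewrite addSn addnS ltnS => ab_w /andP[i2 low_a] /andP[j2 low_b].
have IHab : preterm_lt a b <-> value a < value b by apply: IHw => //; apply: ltnW.
have IHba : preterm_lt b a <-> value b < value a.
  by apply: IHw => //; rewrite addnC ltnW.
have IHcoefa k : (k < 2)%N ->
    preterm_lt (coef k a) (Theta k b) <-> value (coef k a) < value (Theta k b).
  move=> k2; apply: IHw; rewrite /= ?k2 ?low_coef // addnS.
  by rewrite (leq_ltn_trans _ ab_w) // ltnS leq_add2r depth_coef.
have IHcoefb k : (k < 2)%N ->
    preterm_lt (Theta k a) (coef k b) <-> value (Theta k a) < value (coef k b).
  move=> k2; apply: IHw; rewrite /= ?k2 ?low_coef // addSn.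
  by rewrite (leq_ltn_trans _ ab_w) // ltnS leq_add2l depth_coef.
have eq_coefb : i = 0%N -> Theta i a = coef i b <-> value (Theta i a) = value (coef i b).
  move=> i0; split=> [->//|]; apply: value_inj; last exact: low_coef.
  by rewrite unfold_in /= i2.
apply: iff_trans (preterm_lt_Theta i j a b) _.
case: i i2 eq_coefb => [|[|//]] _ eq_coefb; case: j j2 => [|[|//]] _.
- rewrite IHab IHba IHcoefa // IHcoefb // eq_coefb // !value_coef0 //.
  rewrite [value (Theta _ _)]/= [value (Theta _ _)]/=.
  rewrite !(@lt_lexpair (0%N, _)) /= theta0_lt -!surjective_pairing.
  split=> [[//|[_ [|[ba [ab|[ab]]]]]]|[ab|[ba]]].
  - by left.
  - by right; split=> //; apply: ltW.
  - by right; rewrite ab.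
  - by right; split=> //; left.
  rewrite le_eqVlt => /predU1P[ab|ab]; right; split=> //; right; split=> //.
    by right; rewrite ab.
  by left.
- by split=> // _; left.
- by split=> [[|[]]|].
rewrite IHab IHba IHcoefa // IHcoefb // !coef1_low //.
have value_ThetaS c : value c < value (Theta 1 c) by rewrite lt_lexpair /= ltnSn.
have -> : value (Theta 1 a) < value (Theta 1 b) = (value a < value b).
  by rewrite !lt_lexpair.
split=> [[//|[_ [[]//|[ba ab]]]]|ab]; last first.
  by right; split=> //; left; split=> //; apply: lt_trans ab _.
have : value a < value b.
  case: ab => [|<- //]; exact: lt_trans.
by move/(lt_trans ba); rewrite ltxx.
Qed.

Lemma value_surj x : exists a, low a /\ value a = (0%N, x).
Proof.
have [w] := ubnP (cnf_weight x); elim: w x => // w IHw x xw.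
have [->|/theta0_surj[n [y [yx y_lt]]]] := eqVneq x (cnf_nil _); first by exists Zero.
have [a [low_a a_val]] := IHw y (leq_trans y_lt xw).
exists (Theta 0 (iter n (Theta 1) a)).
have [low_na na_val] : low (iter n (Theta 1) a) /\ value (iter n (Theta 1) a) = (n, y).
  by elim: n {yx} => //= n [low_na ->].
by rewrite /= low_na na_val yx.
Qed.

(** The bound is the [Theta 0] of W = [Theta 1] [Omega_2].  The fourth
    clause would need a nonzero coefficient k_0 W, k_1 [Omega_2] or k_2 0, so it
    never applies below these terms, and descending into a term keeps the two
    conditions b < W and k_0 b < [Theta 0] W. *)
Lemma lt_bound a :
  preterm_lt a (Theta 0 (Theta 1 (Theta 2 Zero))) <-> low a && ((value a).1 == 0%N).
Proof.
set W := Theta 1 (Theta 2 Zero); split=> [|/andP[low_a a0]].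
  have low_of : forall b, preterm_lt b W -> preterm_lt (coef 0 b) (Theta 0 W) -> low b.
    elim=> // -[|[|i]] b IHb /=.
    - move=> _ /preterm_lt_Theta[//|[_ [[bW cW]|[_ [/preterm_lt_Zero|]]]]] //.
      exact: IHb.
    - move=> /preterm_lt_Theta[//|[_ [[bO cW]|[_ [/preterm_lt_Zero|]]]]] //.
      apply: IHb; case: b bO cW => [|j b] bO; first by move=> _; apply: lt_zero.
      have j2 : (j < 2)%N.
        case/preterm_lt_Theta: bO => [//|[_ [[/preterm_lt_Zero]|]]] //.
        by move=> [_ [/preterm_lt_Zero|]].
      by rewrite /= -ltnS j2.
    - by case/preterm_lt_Theta=> [|[]].
  case: a => // -[|i] b aW; last by case/preterm_lt_Theta: aW => [|[]].
  by rewrite low_of //; apply: lt_index.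
have [_] : preterm_lt a W /\ preterm_lt (coef 0 a) (Theta 0 W).
  elim: a low_a {a0} => [|[|[|i]] b IHb] //= low_b; first by split; apply: lt_zero.
  - have [bW cW] := IHb low_b.
    by split; [apply: lt_index | apply: lt_arg].
  - have [bW cW] := IHb low_b; split=> //; apply: lt_arg; last by rewrite coef1_low.
    case: b low_b {IHb bW cW} => [|j b] /=; first by move=> _; apply: lt_zero.
    by case/andP=> j2 _; apply: lt_index.
by case: a low_a a0 => // -[|[|i]].
Qed.

Lemma low_in_T a : low a -> in_T a.
Proof.
elim: a => //= i a IHa /andP[i2 low_a]; rewrite IHa //=.
case: a low_a {IHa} => //= j a /andP[j2 _].
by case: i i2 => [|[|//]] _; case: j j2 => [|[|//]].
Qed.

Lemma same_order_type_trans A B C :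
  same_order_type A B -> same_order_type B C -> same_order_type A C.
Proof.
case=> f [f_bij f_lt] [g [g_bij g_lt]]; exists (g \o f); split; first exact: bij_comp.
by move=> x y; rewrite f_lt g_lt.
Qed.

Theorem theorem10 :
  same_order_type
    (@predecessors T_ord (@theta 0 (@theta 1 (Omega 2) isT) isT))
    (oexp omega (oexp omega omega)).
Proof.
set A := predecessors _.
apply: (@same_order_type_trans _ (ord (cnf (cnf nat)))); last first.
  do 2!apply: same_order_type_oexp.
  by exists id; split; first exists id.
have lowA (a : A) : low (sval (sval a)) /\ (value (sval (sval a))).1 = 0%N.
  by have /lt_bound/andP[? /eqP] := svalP a.
pose q (a : A) : ord (cnf (cnf nat)) := (value (sval (sval a))).2.
have q_val (a : A) : value (sval (sval a)) = (0%N, q a).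
  by have [_ a0] := lowA a; rewrite [LHS]surjective_pairing a0.
apply: (@same_order_type_bij A _ q).
- move=> a b qab.
  have: sval (sval a) = sval (sval b); last first.
    case: a b {qab} => [[a aT] aL] [[b bT] bL] /= ab.
    by apply: eq_exist; apply/val_inj.
  apply: value_inj; [exact: (lowA a).1 | exact: (lowA b).1 |].
  by rewrite !q_val qab.
- move=> x; have [a [low_a a_val]] := value_surj x.
  have aL : preterm_lt a (Theta 0 (Theta 1 (Theta 2 Zero))).
    by apply/lt_bound; rewrite low_a a_val.
  exists (exist _ (exist _ a (low_in_T low_a)) aL).
  by rewrite /q /= a_val.
move=> a b; rewrite /= /T_lt (preterm_lt_value (lowA a).1 (lowA b).1).
by rewrite !q_val lt_lexpair.
Qed.
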